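(* Let $n,m\geq 1$ be integers, $p\in(0,1)$, $q=1-p$. The expected number of fixed points $N_1(\pi)$ of $\pi\sim\nu^{(p)}_{n,m}$ is $$\mathbb{E}_{\nu^{(p)}_{n,m}}[N_1(\pi)]=\sum_{r=1}^{n}m^{1-r}\bigl(p^r-(-q)^r\bigr)=\frac{p\,(1-(p/m)^n)}{1-p/m}+\frac{q\,(1-(-q/m)^n)}{1+q/m}.$$
   Context: Asymmetric shelf shuffle: let $m\ge 1$ be an integer, $p\in(0,1)$, $q=1-p$. A deck of $n$ cards labelled $1,\ldots,n$ from top to bottom is dealt sequentially from the bottom (card $n$ first, card $1$ last). Each card is assigned to one of $m$ labelled shelves independently and uniformly at random, and is placed at the top of the existing pile on that shelf with probability $p$ and at the bottom with probability $q$, independently of everything else. The shuffled deck is formed by joining the piles in shelf order (shelf $1$ on top, then shelf $2$, and so on). The resulting random permutation is $\pi=(\pi_1,\ldots,\pi_n)\in S_n$, where $\pi_i$ is the label of the card in position $i$ from the top, and $\nu^{(p)}_{n,m}$ denotes its law on $S_n$. $N_1(\pi)$ is the number of fixed points of $\pi$. *)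

(* Defs.v *)
From HB Require Import structures.
From mathcomp Require Import all_boot all_order all_algebra all_fingroup.
From mathcomp Require Import reals.

Set Implicit Arguments.
Unset Strict Implicit.
Unset Printing Implicit Defensive.

Import Order.TTheory GRing.Theory Num.Theory.
Local Open Scope ring_scope.

(* Cards, positions and shelves are counted from 0: the element i of 'I_n
   stands for the card labelled i + 1, or for the position i + 1 from the top.
   Piles and decks are sequences listed from top to bottom. *)

(* The random choices of the shuffle: for each card, its shelf and whether it
   is placed at the top (true) or at the bottom (false) of the pile there. *)
Definition shelf_choice (n m : nat) := {ffun 'I_n -> 'I_m * bool}.

Section Shuffle.
Variables (n m : nat).
Implicit Type w : shelf_choice n m.

Definition deal_card w (piles : 'I_m -> seq 'I_n) (c : 'I_n) :
    'I_m -> seq 'I_n :=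
  fun s => if s == (w c).1
           then if (w c).2 then c :: piles s else rcons (piles s) c
           else piles s.

Definition shelf_piles w : 'I_m -> seq 'I_n :=
  foldl (deal_card w) (fun=> [::]) (rev (enum 'I_n)).

Definition shelf_deck w : seq 'I_n :=
  flatten [seq shelf_piles w s | s <- enum 'I_m].

Section Law.
Variables (R : realType) (p : R).

Definition choice_prob w : R :=
  \prod_(c < n) (m%:R^-1 * (if (w c).2 then p else 1 - p)).

(* pi i is the label of the card in position i. *)
Definition shelf_law (pi : 'S_n) : R :=
  \sum_(w : shelf_choice n m | shelf_deck w == [seq pi i | i <- enum 'I_n])
    choice_prob w.

End Law.
End Shuffle.

Definition expectation (R : realType) (n : nat) (nu : 'S_n -> R)
    (f : 'S_n -> R) : R :=
  \sum_(pi : 'S_n) nu pi * f pi.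

Definition nb_fixpoints (n : nat) (pi : 'S_n) : nat :=
  #|[set i | pi i == i]|.

(* Main.v *)
Require Import Defs.
From HB Require Import structures.
From mathcomp Require Import all_boot all_order all_algebra all_fingroup.
From mathcomp Require Import reals ring.

Set Implicit Arguments.
Unset Strict Implicit.
Unset Printing Implicit Defensive.

Import Order.TTheory GRing.Theory Num.Theory.
Local Open Scope ring_scope.

(** By linearity the expectation is the sum over the cards c of the probability
    that c ends at position c.  Split every shelf into two slots, its cards
    placed at the top and, below them, those placed at the bottom.  The deck
    lists the slots from top to bottom, in increasing order of labels inside a
    top slot and in decreasing order inside a bottom slot
    ([pairwise_shelf_deck]), so the position of c is the number of cards d that
    precede it, and whether d precedes c depends only on the slots of c and d
    and on which label is smaller ([index_shelf_deck]).

    Condition on the slot v of c.  The other cards are independent: each d < c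
    precedes c with a probability b, each d > c with a probability a, hence the
    position of c has generating function (1 + b(X-1))^c (1 + a(X-1))^(N-c)
    with N = n - 1 ([position_genfun]).  The probability of a fixed point is
    its coefficient at X^c.  The slots strictly above v count in both a and b;
    v itself counts only in b for a top slot and only in a for a bottom slot,
    so b - a is the probability g v of the slot, up to the corresponding sign.

    Summing over c gives the trace of the N-th symmetric power of the 2 x 2
    stochastic matrix with rows (b, 1 - b) and (a, 1 - a), whose eigenvalues
    are 1 and b - a; the trace is therefore the sum of (b - a)^k over
    0 <= k <= N ([sum_coef_mixed_powers]).  It remains to add up the
    contributions g v * (b - a)^k of the m top slots (g v = p/m, b - a = p/m)
    and of the m bottom slots (g v = q/m, b - a = - q/m). *)

(** * The trace of a symmetric power of a stochastic 2 x 2 matrix *)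

Section TraceIdentity.
Variable F : comUnitRingType.

Lemma coef_Xsub1_exp i j :
  (('X - 1 : {poly F}) ^+ i)`_j = (-1) ^+ (i - j) *+ 'C(i, j).
Proof.
rewrite addrC exprDn coef_sum.
under eq_bigr => k _ do
  rewrite coefMn -polyC1 -polyCN -polyC_exp mul_polyC coefZ coefXn.
have [le_ji | lt_ij] := leqP j i.
  rewrite (bigD1 (Ordinal (le_ji : (j < i.+1)%N))) //= eqxx mulr1 big1 ?addr0 //.
  by move=> k; rewrite -val_eqE eq_sym /= => /negPf ->; rewrite mulr0 mul0rn.
rewrite bin_small // mulr0n big1 // => k _.
by rewrite gtn_eqF ?mulr0 ?mul0rn // (leq_ltn_trans _ lt_ij) // -ltnS.
Qed.

(** This is the homogenization of ('X - 1)^i in degree i, evaluated at (A, B)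
    and padded with B^(N-i).  It says that, in degree N, the substitution
    x -> A, y -> B maps (x - y)^i y^(N-i) to (A - B)^i B^(N-i). *)
Lemma homogenized_Xsub1_exp (A B : {poly F}) (N i : nat) : (i <= N)%N ->
  \sum_(c < N.+1) (('X - 1 : {poly F}) ^+ i)`_c *: (A ^+ c * B ^+ (N - c))
    = (A - B) ^+ i * B ^+ (N - i).
Proof.
move=> le_iN; rewrite [A - B]addrC [X in _ = X * _]exprDn big_distrl /=.
rewrite [RHS](big_ord_widen N.+1 (fun k => ((- B) ^+ (i - k) * A ^+ k) *+ 'C(i, k)
   * B ^+ (N - i))) ?ltnS // [RHS]big_mkcond /=.
apply: eq_bigr => k _; rewrite coef_Xsub1_exp ltnS.
case: leqP => [le_ki | lt_ik]; last by rewrite bin_small // mulr0n scale0r.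
rewrite -scalerMnl mulrnAl; congr (_ *+ _).
have -> : (N - k = (i - k) + (N - i))%N by rewrite addnC addnBA // subnK.
rewrite -[in LHS]signr_odd scaler_sign -mulr_sign signr_odd.
by rewrite exprD [(- B) ^+ _]exprNn -!mulrA; congr (_ * _); rewrite mulrCA.
Qed.

(** The left-hand side is the trace of the substitution x -> b x + (1 - b) y,
    y -> a x + (1 - a) y on binary forms of degree N, in the monomial basis and
    dehomogenized by y = 1.  It maps x - y to (b - a)(x - y) and y to
    y + a (x - y), hence is triangular in the basis (x - y)^i y^(N-i), with the
    powers of b - a on the diagonal. *)
Lemma sum_coef_mixed_powers (N : nat) (a b : F) :
  \sum_(c < N.+1)
     ((1 + b *: ('X - 1)) ^+ c * (1 + a *: ('X - 1)) ^+ (N - c))`_c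
    = \sum_(k < N.+1) (b - a) ^+ k.
Proof.
set Y : {poly F} := 'X - 1.
pose A := 1 + b *: Y; pose B := 1 + a *: Y.
(* In the proof M is the matrix of the substitution in the monomial basis, P the
   change of basis, and T the triangular matrix in the new basis; h i is the
   image of the i-th new basis vector, written in the variable x - y. *)
pose h i : {poly F} := (b - a) ^+ i *: ((1 + a *: 'X) ^+ (N - i) * 'X^i).
pose M : 'M[F]_N.+1 := \matrix_(i, j) (A ^+ i * B ^+ (N - i))`_j.
pose P : 'M[F]_N.+1 := \matrix_(i, j) (Y ^+ i)`_j.
pose T : 'M[F]_N.+1 := \matrix_(i, j) (h i)`_j.
have size_h (i : 'I_N.+1) : (size (h i) <= N.+1)%N.
  have size_lin : (size ((1 + a *: 'X)%R : {poly F}) <= 2)%N.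
    rewrite (leq_trans (size_polyD _ _)) // size_poly1 geq_max /=.
    by rewrite (leq_trans (size_scale_leq _ _)) ?size_polyX.
  rewrite (leq_trans (size_scale_leq _ _)) // (leq_trans (size_polyMleq _ _)) //.
  rewrite size_polyXn addnS /= -[leqRHS](subnK (ltnW (ltn_ord i))) leq_add2r.
  rewrite subSn ?leq_ord //.
  rewrite (leq_trans (size_poly_exp_leq _ _)) // ltnS.
  by rewrite -[leqRHS]mul1n leq_mul2r -subn1 leq_subLR size_lin orbT.
have h_Y (i : 'I_N.+1) : \sum_(k < N.+1) (h i)`_k *: Y ^+ k
                       = (A - B) ^+ i * B ^+ (N - i).
  have -> : A - B = (b - a) *: Y.
    by rewrite /A /B opprD addrACA subrr add0r scalerBl.
  have <- : h i \Po Y = ((b - a) *: Y) ^+ i * B ^+ (N - i).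
    rewrite comp_polyZ comp_polyM !rmorphXn /= comp_polyX exprZn mulrC scalerAl.
    by rewrite comp_polyD comp_polyZ comp_polyX comp_polyC.
  rewrite /comp_poly (@horner_coef_wide _ N.+1) ?size_map_polyC //.
  by apply: eq_bigr => k _; rewrite coef_map mul_polyC.
have PM_TP : P *m M = T *m P.
  apply/matrixP => i j; rewrite !mxE.
  transitivity (((A - B) ^+ i * B ^+ (N - i))`_j).
    rewrite -homogenized_Xsub1_exp ?leq_ord // coef_sum.
    by apply: eq_bigr => k _; rewrite !mxE coefZ.
  rewrite -h_Y coef_sum.
  by apply: eq_bigr => k _; rewrite !mxE coefZ.
have P_unit : P \in unitmx.
  rewrite unitmxE det_trig; last first.
    by apply/is_trig_mxP => i j lt_ij; rewrite mxE coef_Xsub1_exp bin_small.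
  rewrite big1 ?unitr1 // => i _.
  by rewrite mxE coef_Xsub1_exp subnn binn.
transitivity (\tr M); first by apply: eq_bigr => i _; rewrite mxE.
have -> : M = invmx P *m (T *m P) by rewrite -PM_TP mulKmx.
rewrite mxtrace_mulC mulmxK //; apply: eq_bigr => i _.
rewrite mxE coefZ coefMXn ltnn subnn -horner_coef0.
by rewrite horner_exp !hornerE expr1n mulr1.
Qed.
End TraceIdentity.

(** * The order of the cards in the shuffled deck *)

Lemma pairwise_rev (T : Type) (r : rel T) s :
  pairwise r (rev s) = pairwise (fun x y => r y x) s.
Proof. by elim: s => //= x s IHs; rewrite rev_cons pairwise_rcons all_rev IHs. Qed.

(** In a sequence that is strictly ordered by r, the entries in front of x are
    exactly those related to x.  Asymmetry keeps x and the entries after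
    it from being counted. *)
Lemma index_pairwise (T : eqType) (r : rel T) s x :
    (forall y z, r y z -> ~~ r z y) -> pairwise r s -> x \in s ->
  index x s = count (r^~ x) s.
Proof.
move=> r_asym; have r_irr y : r y y = false.
  by apply/negP => ryy; move: (r_asym _ _ ryy); rewrite ryy.
elim: s => //= y s IHs /andP[/allP r_ys r_s]; rewrite inE.
have [-> _ | ne_xy /= x_s] := eqVneq x y; last first.
  by rewrite r_ys // IHs.
rewrite r_irr; apply/esym/eqP; rewrite -leqn0 leqNgt -has_count.
by apply/hasPn => z /r_ys /r_asym.
Qed.

Section Deck.
Variables n m : nat.
Implicit Types (u v : 'I_m * bool) (c d : 'I_n) (w : shelf_choice n m).

(** A slot is a pair of a shelf and a side.  The slots are ordered as they lie
    in the deck, lexicographically with the top side first. *)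
Definition slot_above u v :=
  (u.1 < v.1)%N || [&& u.1 == v.1, u.2 & ~~ v.2].

(** The slots v of c and u of d are separate arguments, so that once v is fixed
    this is a condition on u alone: the choices of distinct cards d then stay
    independent. *)
Definition comes_before c v d u :=
  slot_above u v || (u == v) && (if v.2 then d < c else c < d)%N.

Definition precedes w d c := comes_before c (w c) d (w d).

Lemma slot_above_irr v : slot_above v v = false.
Proof. by rewrite /slot_above ltnn andbN andbF. Qed.

Lemma slot_above_asym u v : slot_above u v -> ~~ slot_above v u.
Proof.
case: u v => [s b] [t e]; rewrite /slot_above -!val_eqE /=.
by case: ltngtP b e => // _ [] [].
Qed.

Lemma precedes_irr w : irreflexive (precedes w).
Proof.
by move=> c; rewrite /precedes /comes_before slot_above_irr ltnn if_same andbF.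
Qed.

Lemma precedes_asym w c d : precedes w c d -> ~~ precedes w d c.
Proof.
rewrite /precedes /comes_before => /orP[above | /andP[/eqP <-]].
  rewrite negb_or slot_above_asym //=; apply/nandP; left.
  by apply/eqP => eq_w; move: above; rewrite eq_w slot_above_irr.
by rewrite slot_above_irr eqxx /=; case: ifP => _; case: ltngtP.
Qed.

(** The cards are dealt with decreasing labels, so that every card has a smaller
    label than those already in its pile: labels decrease from the bottom up
    among the cards placed at the top, and from the top down among those placed
    at the bottom. *)
Lemma shelf_pilesE w s :
  shelf_piles w s = [seq c <- enum 'I_n | w c == (s, true)]
                    ++ rev [seq c <- enum 'I_n | w c == (s, false)].
Proof.
rewrite /shelf_piles; elim: (enum _) => //= c l IHl.
rewrite rev_cons foldl_rcons /deal_card IHl.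
case: (w c) => t [] /=; rewrite !xpair_eqE /= ?andbT ?andbF eq_sym.
  by case: eqP.
by case: eqP => //= _; rewrite rev_cons rcons_cat.
Qed.

Lemma mem_shelf_piles w s c : (c \in shelf_piles w s) = ((w c).1 == s).
Proof.
have mem_part b : (c \in [seq c <- enum 'I_n | w c == (s, b)]) = (w c == (s, b)).
  by rewrite mem_filter mem_enum andbT.
rewrite shelf_pilesE mem_cat mem_rev !mem_part.
by case: (w c) => t []; rewrite !xpair_eqE /= ?andbT ?andbF ?orbF.
Qed.

Lemma pairwise_enum_ord k : pairwise (fun i j : 'I_k => i < j)%N (enum 'I_k).
Proof.
have := iota_ltn_sorted 0 k.
by rewrite -val_enum_ord (sorted_pairwise ltn_trans) pairwise_map.
Qed.

Lemma pairwise_shelf_piles w s : pairwise (precedes w) (shelf_piles w s).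
Proof.
rewrite shelf_pilesE pairwise_cat pairwise_rev; apply/and3P; split.
- apply/allrelP => c d; rewrite mem_rev !mem_filter.
  move=> /andP[/eqP wc _] /andP[/eqP wd _].
  by rewrite /precedes wc wd /comes_before /slot_above /= eqxx orbT.
- apply: sub_in_pairwise (filter_all _ _) (pairwise_filter _ (pairwise_enum_ord n)).
  move=> c d /eqP wc /eqP wd /= lt_cd.
  by rewrite /precedes wc wd /comes_before eqxx lt_cd orbT.
apply: sub_in_pairwise (filter_all _ _) (pairwise_filter _ (pairwise_enum_ord n)).
move=> c d /eqP wc /eqP wd /= lt_cd.
by rewrite /precedes wc wd /comes_before eqxx lt_cd orbT.
Qed.

Lemma pairwise_shelf_deck w : pairwise (precedes w) (shelf_deck w).
Proof.
rewrite /shelf_deck; elim: (enum _) (pairwise_enum_ord m) => //= s l IHl.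
move=> /andP[/allP lt_s /IHl pw_l].
rewrite pairwise_cat pairwise_shelf_piles pw_l !andbT; apply/allrelP => c d.
rewrite mem_shelf_piles => /eqP wc /flatten_mapP[t /lt_s lt_st].
rewrite mem_shelf_piles => /eqP wd.
by rewrite /precedes /comes_before /slot_above wc wd lt_st.
Qed.

Lemma mem_shelf_deck w c : c \in shelf_deck w.
Proof.
by apply/flatten_mapP; exists (w c).1; rewrite ?mem_enum // mem_shelf_piles.
Qed.

Lemma perm_shelf_deck w : perm_eq (shelf_deck w) (enum 'I_n).
Proof.
apply: uniq_perm (enum_uniq _) _ => [|c]; last by rewrite mem_enum mem_shelf_deck.
exact: pairwise_uniq (@precedes_irr w) (pairwise_shelf_deck w).
Qed.

Lemma index_shelf_deck w c :
  index c (shelf_deck w) = (\sum_d precedes w d c)%N.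
Proof.
rewrite (index_pairwise (@precedes_asym w)) ?pairwise_shelf_deck ?mem_shelf_deck //.
rewrite (seq.permP (perm_shelf_deck w)) -sum1_count big_mkcond /=.
by rewrite enumT; apply: eq_bigr => d _; case: precedes.
Qed.

End Deck.

Lemma shelf_deck_perm n m (w : shelf_choice n m) :
  exists pi : 'S_n, shelf_deck w = [seq pi i | i <- enum 'I_n].
Proof.
have uniq_deck : uniq (shelf_deck w).
  by rewrite (perm_uniq (perm_shelf_deck w)) enum_uniq.
have size_deck : size (shelf_deck w) = n.
  by rewrite (perm_size (perm_shelf_deck w)) size_enum_ord.
have pi_inj : injective (fun i : 'I_n => nth i (shelf_deck w) i).
  move=> i j; rewrite (set_nth_default i j) ?size_deck // => /eqP.
  by rewrite nth_uniq ?size_deck // => /eqP/val_inj.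
exists (perm pi_inj).
have size_img : size [seq perm pi_inj i | i <- enum 'I_n] = n.
  by rewrite size_map size_enum_ord.
have [n0 | n_gt0] := posnP n.
  by apply: etrans (size0nil _) (esym (size0nil _)); rewrite ?size_deck ?size_img.
pose x0 := Ordinal n_gt0.
apply: (@eq_from_nth _ x0) => [|i]; rewrite size_deck ?size_img // => lt_in.
rewrite (nth_map x0) ?size_enum_ord // permE nth_enum_ord //.
by apply: set_nth_default; rewrite size_deck.
Qed.

(** Only one permutation is compatible with w; its inverse maps a card to its
    position, and has the same fixed points. *)
Lemma sum_deck_fixpoints (F : nzRingType) n m (w : shelf_choice n m) :
  \sum_(pi : 'S_n | shelf_deck w == [seq pi i | i <- enum 'I_n])
     (nb_fixpoints pi)%:R
    = \sum_(c < n) (index c (shelf_deck w) == c)%:R :> F.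
Proof.
have [pi0 deckE] := shelf_deck_perm w.
rewrite (big_pred1 pi0) => [|pi]; last first.
  rewrite /= deckE; apply/eqP/eqP => [eq_pi | -> //]; apply/permP => i.
  by have /eq_in_map/(_ i) -> := eq_pi; rewrite ?mem_enum.
rewrite /nb_fixpoints -sum1_card natr_sum big_mkcond /=.
rewrite (reindex_inj (perm_inj (s := pi0^-1)%g)) /=.
apply: eq_bigr => c _; rewrite inE permKV deckE.
rewrite -{3}(permKV pi0 c) index_map; last exact: perm_inj.
by rewrite index_enum_ord val_eqE eq_sym; case: eqP.
Qed.

Lemma expected_fixpoints (R : realType) n m (p : R) :
  expectation (@shelf_law n m R p) (fun pi : 'S_n => (nb_fixpoints pi)%:R)
    = \sum_(c < n) \sum_(w : shelf_choice n m | index c (shelf_deck w) == c)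
        choice_prob p w.
Proof.
rewrite /expectation /shelf_law; under eq_bigr => pi _ do rewrite big_distrl /=.
rewrite (exchange_big_dep predT) //=.
under eq_bigr => w _ do
  rewrite -big_distrr /= sum_deck_fixpoints big_distrr /=.
rewrite exchange_big /=; apply: eq_bigr => c _.
rewrite [RHS]big_mkcond; apply: eq_bigr => w _.
by case: eqP; rewrite ?mulr1 ?mulr0.
Qed.

(** * Fixed points under a product measure on the slots *)

Section ProductMeasure.
Variables (F : comUnitRingType) (n m : nat) (g : 'I_m * bool -> F).
Hypothesis g_sum1 : \sum_u g u = 1.
Implicit Types (u v : 'I_m * bool) (w : shelf_choice n.+1 m).

Lemma bernoulli_genfun (P : pred ('I_m * bool)) :
  \sum_u g u *: 'X^(P u) = 1 + (\sum_(u | P u) g u) *: ('X - 1) :> {poly F}.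
Proof.
rewrite -[X in X + _]scale1r -g_sum1 (big_mkcond P) /= !scaler_suml -big_split.
apply: eq_bigr => u _ /=.
by case: (P u); rewrite ?expr1 ?expr0 ?scale0r ?addr0 // -scalerDr subrKC.
Qed.

(** For b = v.2 this is the probability that a card of smaller label comes
    before a card in slot v, and for b = ~~ v.2 that a card of larger label
    does: inside a slot the label order is increasing exactly on the top
    side. *)
Definition weight_above b v := \sum_(u | slot_above u v || (u == v) && b) g u.

Lemma prod_below_above (A B : {poly F}) (c : 'I_n.+1) :
  \prod_(d < n.+1 | d != c) (if (d < c)%N then A else B) = A ^+ c * B ^+ (n - c).
Proof.
rewrite -(big_mkord (fun d => d != c) (fun d => if (d < c)%N then A else B)).
rewrite (big_cat_nat (leq0n c) (ltnW (ltn_ord c))) /=.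
rewrite [X in _ * X]big_ltn_cond ?ltn_ord // eqxx /=.
have constE X i j : (forall d, (i <= d < j)%N ->
    (if d != c then if (d < c)%N then A else B else 1) = X) ->
    \prod_(i <= d < j | d != c) (if (d < c)%N then A else B) = X ^+ (j - i).
  move=> eqX; rewrite big_mkcond -prodr_const_nat; exact: eq_big_nat.
rewrite (constE A) => [|d /andP[_ lt_dc]]; last by rewrite ltn_eqF ?lt_dc.
rewrite (constE B) => [|d /andP[lt_cd _]]; last by rewrite gtn_eqF // ltnNge ltnW.
by rewrite subn0 subSS.
Qed.

(** Once the slot v of c is fixed, the weight of w and the monomial counting the
    cards that precede c are both products over the other cards, so the sum
    over w factors into one Bernoulli generating function per card. *)
Lemma position_genfun (c : 'I_n.+1) :
  \sum_(w : shelf_choice n.+1 m) (\prod_d g (w d)) *: 'X^(index c (shelf_deck w))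
    = \sum_v g v *: ((1 + weight_above v.2 v *: ('X - 1)) ^+ c
        * (1 + weight_above (~~ v.2) v *: ('X - 1)) ^+ (n - c)) :> {poly F}.
Proof.
rewrite (partition_big (fun w => w c) predT) //=; apply: eq_bigr => v _.
(* The factor of c itself forces its slot to be v. *)
pose G d u : {poly F} :=
  if d == c then (if u == v then (g v)%:P else 0)
  else g u *: 'X^(comes_before c v d u).
transitivity (\prod_d \sum_u G d u).
  rewrite bigA_distr_bigA big_mkcond; apply: eq_bigr => w _ /=.
  rewrite [RHS](bigD1 c) //= {1}/G eqxx; case: eqP => [wc | _]; last by rewrite mul0r.
  rewrite index_shelf_deck expr_sum (bigD1 c) //= [X in _ *: X](bigD1 c) //=.
  rewrite precedes_irr expr0 mul1r wc -scalerA mul_polyC; congr (_ *: _).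
  rewrite -scaler_prod; apply: eq_bigr => d /negPf ne_dc.
  by rewrite /G ne_dc /precedes wc.
rewrite (bigD1 c) //= -mul_polyC; congr (_ * _).
  by rewrite /G eqxx -big_mkcond /= (big_pred1 v).
rewrite -prod_below_above; apply: eq_bigr => d ne_dc.
rewrite /G (negPf ne_dc) bernoulli_genfun /weight_above /comes_before.
have -> : (d < c)%N = ~~ (c < d)%N by rewrite -leqNgt ltn_neqAle ne_dc.
by case: v.2; case: (c < d)%N.
Qed.

Lemma prob_fixed (c : 'I_n.+1) :
  \sum_(w : shelf_choice n.+1 m | index c (shelf_deck w) == c) \prod_d g (w d)
  = \sum_v g v * ((1 + weight_above v.2 v *: ('X - 1)) ^+ c
        * (1 + weight_above (~~ v.2) v *: ('X - 1)) ^+ (n - c) : {poly F})`_c.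
Proof.
have /(congr1 (fun P : {poly F} => P`_c)) := position_genfun c.
rewrite !coef_sum; under [in RHS]eq_bigr do rewrite coefZ; move=> <-.
rewrite big_mkcond; apply: eq_bigr => w _; rewrite coefZ coefXn eq_sym.
by case: eqP; rewrite ?mulr1 ?mulr0.
Qed.

(** The two parameters of [sum_coef_mixed_powers] differ by the weight of the
    slot v alone, and the sign of the difference depends on its side. *)
Lemma sum_prob_fixed :
  \sum_(c < n.+1)
    \sum_(w : shelf_choice n.+1 m | index c (shelf_deck w) == c) \prod_d g (w d)
  = \sum_v g v * \sum_(k < n.+1) (if v.2 then g v else - g v) ^+ k.
Proof.
under eq_bigr => c _ do rewrite prob_fixed.
rewrite exchange_big /=; apply: eq_bigr => v _.
rewrite -big_distrr /= sum_coef_mixed_powers; congr (_ * _).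
have weightT : weight_above true v = g v + weight_above false v.
  rewrite /weight_above (bigD1 v) /= ?eqxx ?orbT //; congr (_ + _).
  apply: eq_bigl => u; rewrite andbT andbF orbF.
  by case: eqVneq => [->|]; rewrite ?slot_above_irr ?orbF ?andbT.
by apply: eq_bigr => k _; congr (_ ^+ _); case: v.2;
  rewrite weightT /= ?addrK // opprD addrCA subrr addr0.
Qed.

End ProductMeasure.

(** * The expected number of fixed points *)

Theorem corollary2p4 (R : realType) (n m : nat) (p q : R)
    (hn : (1 <= n)%N) (hm : (1 <= m)%N)
    (hp0 : 0 < p) (hp1 : p < 1) (hq : q = 1 - p) :
  expectation (shelf_law m p) (fun pi : 'S_n => (nb_fixpoints pi)%:R)
    = \sum_(1 <= r < n.+1) m%:R ^ (1 - r%:Z) * (p ^+ r - (- q) ^+ r)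
  /\
  \sum_(1 <= r < n.+1) m%:R ^ (1 - r%:Z) * (p ^+ r - (- q) ^+ r)
    = p * (1 - (p / m%:R) ^+ n) / (1 - p / m%:R)
      + q * (1 - (- q / m%:R) ^+ n) / (1 + q / m%:R).
Proof.
have m_ge1 : 1 <= m%:R :> R by rewrite ler1n.
have m_neq0 : m%:R != 0 :> R by rewrite pnatr_eq0 -lt0n.
have q_gt0 : 0 < q by rewrite hq subr_gt0.
have sumE : \sum_(1 <= r < n.+1) m%:R ^ (1 - r%:Z) * (p ^+ r - (- q) ^+ r)
    = p * (\sum_(k < n) (p / m%:R) ^+ k) + q * (\sum_(k < n) (- q / m%:R) ^+ k).
  rewrite big_add1 /= big_mkord !mulr_sumr -big_split; apply: eq_bigr => k _ /=.
  have -> : 1 - k.+1%:Z = - k%:Z by rewrite intS opprD addrA subrr add0r.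
  rewrite -exprz_inv -exprnP exprVn !expr_div_n !exprS; field.
  by rewrite expf_neq0.
split; rewrite sumE.
  pose g (v : 'I_m * bool) : R := m%:R^-1 * (if v.2 then p else 1 - p).
  have sum_slots (f : bool -> R) :
      \sum_(v : 'I_m * bool) f v.2 = m%:R * (f true + f false).
    rewrite -(pair_bigA _ (fun _ b => f b)) /= sumr_const card_ord.
    by rewrite big_bool mulr_natl.
  have g_sum1 : \sum_v g v = 1.
    rewrite (sum_slots (fun b => m%:R^-1 * (if b then p else 1 - p))) /=.
    by field.
  rewrite expected_fixpoints; case: n hn {sumE} => // n _.
  rewrite (sum_prob_fixed n g_sum1).
  rewrite (sum_slots (fun b => (m%:R^-1 * (if b then p else 1 - p)) *
    \sum_(k < n.+1) (if b then m%:R^-1 * (if b then p else 1 - p)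
        else - (m%:R^-1 * (if b then p else 1 - p))) ^+ k)) /=.
  by rewrite -hq mulrDr !mulrA mulfV // !mul1r [p / _]mulrC [- q / _]mulrC mulrN.
have geom (x : R) : x != 1 -> \sum_(k < n) x ^+ k = (1 - x ^+ n) / (1 - x).
  move=> x_neq1; have dx_neq0 : 1 - x != 0 by rewrite subr_eq0 eq_sym.
  rewrite -[LHS](mulfK dx_neq0); congr (_ / _).
  by rewrite -[RHS]opprB subrX1 -mulNr opprB mulrC.
rewrite !geom ?mulrA.
- by rewrite mulNr opprK.
- by rewrite mulNr lt_eqF // (@lt_trans _ _ 0) ?oppr_lt0 ?divr_gt0 ?(lt_le_trans _ m_ge1).
by rewrite lt_eqF // ltr_pdivrMr ?(lt_le_trans _ m_ge1) // mul1r (lt_le_trans hp1).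
Qed.
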